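(* Let $(X,d)$ be a complete metric space, let $\Sigma$ be a non-empty dense family whose members are non-empty closed subsets of $X$, and let $f\colon X\to\mathbb{R}$. Then: (1) $f$ has the HSOP with respect to $\Sigma$ if and only if Player II has a winning strategy in the game $G_1(\Sigma,f)$; (2) $f$ does not have the HSOP with respect to $\Sigma$ if and only if Player I has a winning strategy in the game $G_1(\Sigma,f)$. In particular, the game $G_1(\Sigma,f)$ is determined.
   Context: For $g\colon A\to\mathbb{R}$ with $A\subseteq X$ and $x\in A$, the oscillation is $\operatorname{osc}(g,x):=\lim_{\varepsilon\to0^+}\operatorname{diam}(g(A\cap B(x,\varepsilon)))$, where $B(x,\varepsilon)$ is the open ball in $X$. A family $\Sigma$ of non-empty subsets of $X$ is dense if for each $P\in\Sigma$ and every ball $B(x,r)$ with $x\in P$ there exists $Q\in\Sigma$ with $Q\subseteq P\cap B(x,r)$. A function $f\colon X\to\mathbb{R}$ has the hereditary small oscillation property (HSOP) with respect to $\Sigma$ if for every $\alpha>0$ and each $P\in\Sigma$ there exists $Q\in\Sigma$ with $Q\subseteq P$ such that $\operatorname{osc}(f\restriction Q,x)<\alpha$ for all $x\in Q$. The game $G_1(\Sigma,f)$: Player I plays $P\in\Sigma$, Player II plays $P_0$; then at the $n$th step ($n\ge1$) Player I plays a point $x_n$ and Player II plays a set $P_n$. The rules are: $P_n\in\Sigma$ and $P_n\subseteq P$ for all $n\ge0$ (the $P_n$ need not be decreasing), and $x_{n+1}\in P_n$ for all $n\ge 0$. Player II wins if $\langle x_n\rangle$ converges in $X$ and $\lim_{n}f(x_n)=f(\lim_{n}x_n)$;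 otherwise Player I wins. The game is determined if one of the players has a winning strategy. *)

(* Defs.v *)
From HB Require Import structures.
From mathcomp Require Import all_boot all_order all_algebra.
From mathcomp Require Import all_classical all_reals all_analysis.

Set Implicit Arguments.
Unset Strict Implicit.
Unset Printing Implicit Defensive.

Import Order.TTheory GRing.Theory Num.Theory.
Import numFieldNormedType.Exports.

Local Open Scope classical_set_scope.
Local Open Scope ring_scope.

#[short(type="completeMetricType")]
HB.structure Definition CompleteMetric (R : numDomainType) :=
  {T of Metric R T & Complete T}.

(* The diameter may be infinite; it is -oo on the empty set. *)
Definition diam (R : realType) (B : set R) : \bar R :=
  ereal_sup [set (`|p.1 - p.2|)%:E | p in B `*` B].

(* Oscillation at x of the restriction of f to A, meant for x in A. The
   diameter is nondecreasing in e, hence the limit exists in \bar R. *)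
Definition osc (R : realType) (X : metricType R) (f : X -> R) (A : set X)
    (x : X) : \bar R :=
  lim (diam (f @` (A `&` ball x e)) @[e --> 0^'+]).

Definition dense_family (R : realType) (X : metricType R)
    (Sigma : set (set X)) : Prop :=
  forall P, Sigma P -> forall (x : X) (r : R), P x -> 0 < r ->
    exists2 Q, Sigma Q & Q `<=` P `&` ball x r.

Definition HSOP (R : realType) (X : metricType R) (Sigma : set (set X))
    (f : X -> R) : Prop :=
  forall alpha : R, 0 < alpha -> forall P, Sigma P ->
    exists Q, [/\ Sigma Q, Q `<=` P &
      forall x, Q x -> (osc f Q x < alpha%:E)%E].

(* A play of G_1(Sigma, f) is P, P_0, x_1, P_1, x_2, P_2, ...
   The sequence x is indexed from 0: x n stands for x_(n+1), the answer of
   Player I to P_n. *)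
Definition legal_set (X : Type) (Sigma : set (set X)) (P Q : set X) : Prop :=
  Sigma Q /\ Q `<=` P.

Definition playerII_wins (R : realType) (X : completeMetricType R)
    (f : X -> R) (x : nat -> X) : Prop :=
  cvg (x @ \oo) /\ f (x n) @[n --> \oo] --> f (lim (x @ \oo)).

(* A strategy is a function of the moves made so far by the opponent. A winning
   strategy must obey the rules at every finite stage up to which the opponent
   has obeyed them (otherwise a player could win by blocking the game), and
   must win every infinite play in which the opponent obeys the rules. *)

(* P_n = s P [:: x_1; ...; x_n] *)
Definition winning_strategyII (R : realType) (X : completeMetricType R)
    (Sigma : set (set X)) (f : X -> R) (s : set X -> seq X -> set X) : Prop :=
  forall P, Sigma P -> forall x : nat -> X,
    let P_ n := s P (mkseq x n) in
    (forall n, (forall k, (k < n)%N -> P_ k (x k)) ->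
       legal_set Sigma P (P_ n)) /\
    ((forall n, P_ n (x n)) -> playerII_wins f x).

(* P is the opening move of Player I, and x_(n+1) = t [:: P_0; ...; P_n] *)
Definition winning_strategyI (R : realType) (X : completeMetricType R)
    (Sigma : set (set X)) (f : X -> R) (P : set X)
    (t : seq (set X) -> X) : Prop :=
  Sigma P /\ forall P_ : nat -> set X,
    let x n := t (mkseq P_ n.+1) in
    (forall n, (forall k, (k <= n)%N -> legal_set Sigma P (P_ k)) ->
       P_ n (x n)) /\
    ((forall n, legal_set Sigma P (P_ n)) -> ~ playerII_wins f x).

Definition playerII_has_winning_strategy (R : realType)
    (X : completeMetricType R) (Sigma : set (set X)) (f : X -> R) : Prop :=
  exists s, winning_strategyII Sigma f s.

Definition playerI_has_winning_strategy (R : realType)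
    (X : completeMetricType R) (Sigma : set (set X)) (f : X -> R) : Prop :=
  exists P t, winning_strategyI Sigma f P t.

Definition determined (R : realType) (X : completeMetricType R)
    (Sigma : set (set X)) (f : X -> R) : Prop :=
  playerI_has_winning_strategy Sigma f \/ playerII_has_winning_strategy Sigma f.

(* Main.v *)
Require Import Defs.
From HB Require Import structures.
From mathcomp Require Import all_boot all_order all_algebra.
From mathcomp Require Import all_classical all_reals all_analysis.
From mathcomp Require Import lra.

(** Three facts give the theorem: the HSOP provides a strategy for Player II, its
    failure provides one for Player I, and the two players cannot both have a
    winning strategy, since these could be played against each other.

    If the HSOP holds, Player II maintains a decreasing sequence of sets P_n on
    which the oscillation of f is everywhere below 1/(n+1)
    ([shrinking_response]). When a point x_n of P_n arrives, the bound on the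
    oscillation at x_n gives a ball around x_n on which f restricted to P_n varies
    by less than 1/(n+1); density puts a member of the family in a smaller ball,
    of radius at most 1/(n+1), and the HSOP shrinks that member further. The
    points x_n then form a Cauchy sequence, whose limit lies in all the closed
    sets P_n, so that f takes at the limit and at the late points of the sequence
    values that are at most 1/(n+1) apart ([shrinking_play_wins]).

    If the HSOP fails, there are a > 0 and P in the family such that f varies by
    more than a/2 on every member of the family contained in P. Hence, wherever
    the previous point was, every P_n contains a point at which f differs from its
    previous value by more than a/4 ([far_value]). Player I opens with P and plays
    such points. The values f(x_n) are then not Cauchy, and Player II
    loses whether or not the points converge. *)

Import Order.TTheory GRing.Theory Num.Theory.
Import numFieldNormedType.Exports.

Local Open Scope classical_set_scope.
Local Open Scope ring_scope.

(** The diameter of the image grows with the radius, so the limit at 0 is an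
    infimum; upper bounds on the oscillation are then read off single balls. *)
Lemma osc_inf (R : realType) (X : metricType R) (f : X -> R) (A : set X)
    (x : X) :
  osc f A x = ereal_inf [set diam (f @` (A `&` ball x e)) | e in `]0, +oo[].
Proof.
apply: cvg_lim => //; apply: nondecreasing_at_right_cvge => // e1 e2 _ _ le12.
apply: ereal_sup_le => _ [[_ _] [[y [Ay xy] <-] [z [Az xz] <-]] <-].
exists (f y, f z) => //; split.
- by exists y => //; split => //; apply: le_ball xy.
- by exists z => //; split => //; apply: le_ball xz.
Qed.

Lemma osc_le (R : realType) (X : metricType R) (f : X -> R) (A : set X)
    (x : X) (c : R) :
  (forall y z, A y -> A z -> `|f y - f z| <= c) -> (osc f A x <= c%:E)%E.
Proof.
move=> fA; rewrite osc_inf; apply: ge_ereal_inf.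
exists (diam (f @` (A `&` ball x 1))).
  by exists 1 => //=; rewrite in_itv /= ltr01.
apply: ge_ereal_sup => _ [[_ _] [[y [Ay _] <-] [z [Az _] <-]] <-].
by rewrite lee_fin; apply: fA.
Qed.

Lemma osc_lt_ball (R : realType) (X : metricType R) (f : X -> R) (A : set X)
    (x : X) (c : R) :
  (osc f A x < c%:E)%E ->
  exists2 e : R, 0 < e & forall y z, A y -> A z -> ball x e y -> ball x e z ->
    `|f y - f z| < c.
Proof.
rewrite osc_inf => /ereal_inf_lt[_ [e /= e0 <-] ltc].
rewrite in_itv /= andbT in e0.
exists e => // y z Ay Az xy xz; rewrite -lte_fin; apply: le_lt_trans ltc.
by apply: ereal_sup_ubound; exists (f y, f z) => //; split; [exists y|exists z].
Qed.

(** Player II's answer to the point x: the set Q' is still of small oscillation,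
    with the next bound c', so that the answer can be repeated. *)
Lemma shrinking_response (R : realType) (X : metricType R)
    (Sigma : set (set X)) (f : X -> R) (Q : set X) (x : X) (r c c' : R) :
  dense_family Sigma -> HSOP Sigma f -> 0 < r -> 0 < c' -> Sigma Q -> Q x ->
  (osc f Q x < c%:E)%E ->
  exists Q', [/\ Sigma Q', Q' `<=` Q, Q' `<=` ball x r,
    forall y z, Q' y -> Q' z -> `|f y - f z| < c &
    forall y, Q' y -> (osc f Q' y < c'%:E)%E].
Proof.
move=> dense hsop r0 c'0 SQ Qx /osc_lt_ball[e e0 fe].
have [|Q1 SQ1 Q1sub] := dense Q SQ x (Num.min e r) Qx.
  by rewrite lt_min e0.
have [Q2 [SQ2 Q21 oscQ2]] := hsop c' c'0 Q1 SQ1.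
have Q2in y : Q2 y -> [/\ Q y, ball x e y & ball x r y].
  move=> /Q21/Q1sub[Qy xy]; split => //; apply: le_ball xy;
    by rewrite ge_min lexx ?orbT.
exists Q2; split => //.
- by move=> y /Q2in[].
- by move=> y /Q2in[].
- by move=> y z /Q2in[Qy xy _] /Q2in[Qz xz _]; apply: fe.
Qed.

(** The bounds on f compare the late points with their limit because closedness
    and monotonicity put both in the same P_n. *)
Lemma shrinking_play_wins (R : realType) (X : completeMetricType R)
    (f : X -> R) (P_ : nat -> set X) (x : nat -> X) :
  (forall n, closed (P_ n)) -> (forall n, P_ n (x n)) ->
  (forall n, P_ n.+1 `<=` P_ n) ->
  (forall n, P_ n.+1 `<=` ball (x n) n.+1%:R^-1) ->
  (forall n y z, P_ n.+1 y -> P_ n.+1 z -> `|f y - f z| < n.+1%:R^-1) ->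
  playerII_wins f x.
Proof.
move=> P_closed Px P_decr P_small f_small.
have P_le m n : (m <= n)%N -> P_ n `<=` P_ m.
  elim: n => [|n IH]; first by rewrite leqn0 => /eqP ->.
  by rewrite leq_eqVlt => /orP[/eqP -> //|/IH Pnm y /P_decr/Pnm].
have P_late n : \forall m \near \oo, P_ n (x m).
  by exists n => // m /= nm; apply: (P_le n m nm); apply: Px.
have x_cvg : cvg (x @ \oo).
  apply: cauchy_cvg; apply/cauchy_ballP => e e0.
  have e2 : 0 < e / 2 by rewrite divr_gt0.
  have [n _ /(_ n (leqnn n)) /= ltn] := near_infty_natSinv_lt (PosNum e2).
  exists ([set y | P_ n.+1 y], [set y | P_ n.+1 y]) => /=.
    by split; apply: P_late.
  move=> [y z] /= [Py Pz]; apply: (@ball_split _ _ (x n)).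
  - by apply: ball_sym; apply: le_ball (P_small _ _ Py); apply: ltW.
  - by apply: le_ball (P_small _ _ Pz); apply: ltW.
split=> //.
have P_lim n : P_ n (lim (x @ \oo)).
  by apply: (closed_cvg _ (P_closed n) (P_late n)); exact: x_cvg.
apply/cvgrPdist_lt => e e0.
have [n _ /(_ n (leqnn n)) /= ltn] := near_infty_natSinv_lt (PosNum e0).
apply: filterS (P_late n.+1) => m Pm.
by apply: lt_trans ltn; apply: f_small.
Qed.

Lemma HSOP_winning_strategyII (R : realType) (X : completeMetricType R)
    (Sigma : set (set X)) (f : X -> R) :
  (forall P, Sigma P -> closed P) -> dense_family Sigma -> HSOP Sigma f ->
  playerII_has_winning_strategy Sigma f.
Proof.
move=> Sigma_closed dense hsop.
pose good n Q := Sigma Q /\ forall y, Q y -> (osc f Q y < (n.+1%:R^-1)%:E)%E.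
have /choice[start startP] : forall P, exists Q,
    Sigma P -> good 0 Q /\ Q `<=` P.
  move=> P; have [SP|nSP] := pselect (Sigma P); last by exists P.
  have [|Q [SQ QP oscQ]] := hsop 1%:R^-1 _ P SP; first by rewrite invr_gt0.
  by exists Q.
have /choice[next nextP] : forall p : nat * set X * X, exists Q',
    good p.1.1 p.1.2 -> p.1.2 p.2 ->
    [/\ good p.1.1.+1 Q', Q' `<=` p.1.2, Q' `<=` ball p.2 p.1.1.+1%:R^-1 &
      forall y z, Q' y -> Q' z -> `|f y - f z| < p.1.1.+1%:R^-1].
  move=> [[n Q] x] /=.
  have [[[SQ oscQ] Qx]|nQ] := pselect (good n Q /\ Q x); last first.
    by exists Q => gQ Qx; case: nQ.
  have [||Q' [SQ' Q'Q Q'x fQ' oscQ']] := @shrinking_response R X Sigma f Q x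
    n.+1%:R^-1 n.+1%:R^-1 n.+2%:R^-1 dense hsop _ _ SQ Qx (oscQ x Qx).
  - by rewrite invr_gt0.
  - by rewrite invr_gt0.
  - by exists Q'.
(* The round number is carried along because it fixes the next radius and the
   next bound on the oscillation. *)
pose state P xs := foldl (fun (nQ : nat * set X) x => (nQ.1.+1, next (nQ, x)))
  (0%N, start P) xs.
exists (fun P xs => (state P xs).2) => P SP x P_.
have P_S n : P_ n.+1 = next (n, P_ n, x n).
  have size_state m : (state P (mkseq x m)).1 = m.
    by elim: m => // m IH; rewrite mkseqS /state foldl_rcons /= -/(state P _) IH.
  rewrite /P_ mkseqS /state foldl_rcons /= -/(state P _).
  by rewrite [X in next (X, _)]surjective_pairing size_state.
have P_good n : (forall k, (k < n)%N -> P_ k (x k)) ->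
    good n (P_ n) /\ P_ n `<=` P.
  elim: n => [_|n IH xP]; first exact: startP SP.
  have [|gn nP] := IH; first by move=> k kn; apply: xP; apply: ltnW.
  have /= [gS sub _ _] := nextP (n, P_ n, x n) gn (xP n (ltnSn n)).
  by rewrite P_S; split=> // y /sub/nP.
split=> [n /P_good[[SPn _] nP] //|xP].
have P_goodA n : good n (P_ n) by have [] := P_good n (fun k _ => xP k).
have step n := nextP (n, P_ n, x n) (P_goodA n) (xP n).
apply: (@shrinking_play_wins _ _ f P_ x) => // n; rewrite ?P_S;
  try by have [] := step n.
by apply: Sigma_closed; have [] := P_goodA n.
Qed.

(** Two values of f on Q that are more than 2c apart cannot both be c-close to v. *)
Lemma far_value (R : realType) (X : metricType R) (f : X -> R) (Q : set X)
    (x : X) (c v : R) :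
  ((c *+ 2)%:E < osc f Q x)%E -> exists2 z, Q z & c < `|f z - v|.
Proof.
move=> ltosc; apply: contrapT => close.
have {}close z : Q z -> `|f z - v| <= c.
  by move=> Qz; rewrite leNgt; apply/negP => ltc; apply: close; exists z.
move: ltosc; rewrite ltNge => /negP; apply; apply: osc_le => y z Qy Qz.
rewrite mulr2n (le_trans (ler_distD v _ _)) // lerD ?close //.
by rewrite distrC close.
Qed.

Lemma not_HSOP_winning_strategyI (R : realType) (X : completeMetricType R)
    (Sigma : set (set X)) (f : X -> R) :
  (forall P, Sigma P -> P !=set0) -> ~ HSOP Sigma f ->
  playerI_has_winning_strategy Sigma f.
Proof.
move=> Sigma_nonempty nhsop.
have [a [a0 [P [SP oscP]]]] : exists a : R, 0 < a /\ exists P, Sigma P /\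
    forall Q, legal_set Sigma P Q -> exists2 x, Q x & (a%:E <= osc f Q x)%E.
  apply: contrapT => none; apply: nhsop => a a0 P SP; apply: contrapT => noQ.
  apply: none; exists a; split=> //; exists P; split=> // Q [SQ QP].
  apply: contrapT => nox; apply: noQ; exists Q; split=> // x Qx.
  by rewrite ltNge; apply/negP => le_a; apply: nox; exists x.
have /choice[next nextP] : forall p : X * set X, exists z,
    legal_set Sigma P p.2 -> p.2 z /\ a / 4 < `|f z - f p.1|.
  move=> [y Q] /=.
  have [LQ|nLQ] := pselect (legal_set Sigma P Q); last by exists y.
  have [x Qx osc_a] := oscP Q LQ.
  have [|z Qz far] := @far_value R X f Q x (a / 4) (f y); last by exists z.
  by apply: lt_le_trans osc_a; rewrite lte_fin; lra.
have [x0 _] := Sigma_nonempty P SP.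
pose t Qs := foldl (fun y Q => next (y, Q)) x0 Qs.
exists P, t; split=> // P_ x.
have x_next n : x n = next (t (mkseq P_ n), P_ n).
  by rewrite /x mkseqS /t foldl_rcons.
split=> [n legal|legal [_ f_cvg]].
  by rewrite x_next; have [] := nextP (t (mkseq P_ n), P_ n) (legal n (leqnn n)).
(* If f(x_n) had a limit, two consecutive values would eventually be within
   a/8 of it, hence within a/4 of each other. *)
have a8 : 0 < a / 8 by rewrite divr_gt0.
have /cvgrPdist_lt/(_ _ a8)[N _ close] := f_cvg.
have jump : a / 4 < `|f (x N.+1) - f (x N)|.
  by rewrite x_next; have [] := nextP (t (mkseq P_ N.+1), P_ N.+1) (legal N.+1).
have closeN := close N (leqnn N); have closeS := close N.+1 (leqnSn N).
have := ler_distD (f (lim (x @ \oo))) (f (x N.+1)) (f (x N)).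
rewrite /= (distrC (f (x N.+1)) (f (lim _))) in closeN closeS *.
move: jump closeN closeS; lra.
Qed.

Lemma strategies_exclusive (R : realType) (X : completeMetricType R)
    (Sigma : set (set X)) (f : X -> R) :
  playerI_has_winning_strategy Sigma f ->
  ~ playerII_has_winning_strategy Sigma f.
Proof.
move=> [P [t [SP winI]]] [s winII].
(* The histories of the points and of the sets in the play of t against s. *)
pose step (h : seq X * seq (set X)) :=
  let Ps := rcons h.2 (s P h.1) in (rcons h.1 (t Ps), Ps).
pose h n := iter n step ([::], [::]).
pose x n := t (h n.+1).2; pose P_ n := s P (h n).1.
have hE n : h n = (mkseq x n, mkseq P_ n).
  elim: n => // n IH; rewrite !mkseqS.
  rewrite [LHS](_ : _ = (rcons (h n).1 (x n), rcons (h n).2 (P_ n))) //.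
  by rewrite IH.
have xE n : x n = t (mkseq P_ n.+1) by rewrite /x hE.
have P_E n : P_ n = s P (mkseq x n) by rewrite /P_ hE.
have [legalI lossII] := winI P_; have [legalII winsII] := winII P SP x.
have legal n : legal_set Sigma P (P_ n) /\ P_ n (x n).
  elim/ltn_ind: n => n IH.
  have Ln : legal_set Sigma P (P_ n).
    by rewrite P_E; apply: legalII => k kn; rewrite -P_E; have [] := IH k kn.
  split=> //; rewrite xE; apply: legalI => k; rewrite leq_eqVlt.
  by move=> /orP[/eqP -> //|/IH[]].
apply: lossII => [n|]; first by have [] := legal n.
rewrite -(_ : x = fun n => t (mkseq P_ n.+1)); last exact/funext/xE.
by apply: winsII => n; rewrite -P_E; have [] := legal n.
Qed.

Theorem theorem3p1 (R : realType) (X : completeMetricType R)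
    (Sigma : set (set X)) (f : X -> R)
    (Sigma_nonempty : Sigma !=set0)
    (Sigma_members : forall P, Sigma P -> P !=set0 /\ closed P)
    (Sigma_dense : dense_family Sigma) :
  [/\ HSOP Sigma f <-> playerII_has_winning_strategy Sigma f,
      ~ HSOP Sigma f <-> playerI_has_winning_strategy Sigma f &
      determined Sigma f].
Proof.
have hII : HSOP Sigma f -> playerII_has_winning_strategy Sigma f.
  by apply: HSOP_winning_strategyII => // P /Sigma_members[].
have hI : ~ HSOP Sigma f -> playerI_has_winning_strategy Sigma f.
  by apply: not_HSOP_winning_strategyI => P /Sigma_members[].
have excl := @strategies_exclusive R X Sigma f.
split.
- by split=> // wII; apply: contrapT => /hI/excl.
- by split=> // wI /hII; apply: excl.
- by have [/hII|/hI] := pselect (HSOP Sigma f); [right|left].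
Qed.
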